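(* Let $\alpha=(\alpha_1,\ldots,\alpha_s)$ be any composition of $n$ with $s\ge 1$ parts, and let $r(\alpha)=(r_0,r_1,\ldots,r_{n+1})$ be the rank sequence of the lattice of lower order ideals of the fence poset $F(\alpha)$. Then $r(\alpha)$ is unimodal; equivalently, the rank polynomial $R(\alpha;q)=\sum_{k} r_k q^k$ is unimodal.
   Context: A composition $\alpha=(\alpha_1,\ldots,\alpha_s)$ of $n$ is a sequence of positive integers with sum $n$. The fence poset $F(\alpha)$ is the poset on $x_1,\ldots,x_{n+1}$ generated by the relations $x_1\preceq x_2\preceq\cdots\preceq x_{\alpha_1+1}\succeq x_{\alpha_1+2}\succeq\cdots\succeq x_{\alpha_1+\alpha_2+1}\preceq x_{\alpha_1+\alpha_2+2}\preceq\cdots\preceq x_{\alpha_1+\alpha_2+\alpha_3+1}\succeq\cdots$, i.e. consecutive elements $x_j,x_{j+1}$ are comparable, the first $\alpha_1$ steps go up, the next $\alpha_2$ go down, and so on alternately. A lower order ideal is a subset $I$ such that $x\in I$ and $y\preceq x$ imply $y\in I$. The rank sequence $r(\alpha)=(r_0,\ldots,r_{n+1})$ has $r_k$ equal to the number of lower order ideals of $F(\alpha)$ of cardinality $k$. A sequence $a_0,\ldots,a_m$ is unimodal if there is an index $j$ with $a_0\le\cdots\le a_j\ge a_{j+1}\ge\cdots\ge a_m$. *)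

(* Defs.v *)
From mathcomp Require Import all_boot all_order all_algebra.

Set Implicit Arguments.
Unset Strict Implicit.
Unset Printing Implicit Defensive.

Definition is_composition (n : nat) (alpha : seq nat) : bool :=
  all (fun a => 0 < a) alpha && (sumn alpha == n).

(* Elements and steps are numbered from 0: the ordinal j stands for x_(j+1),
   and step j joins ordinals j and j.+1. Step j belongs to the part of alpha
   with 0-based index reshape_index alpha j; even-indexed parts go up. *)
Definition step_up (alpha : seq nat) (j : nat) : bool :=
  ~~ odd (reshape_index alpha j).

Definition fence_step (alpha : seq nat) : rel 'I_(sumn alpha).+1 :=
  fun x y => ((y == x.+1 :> nat) && step_up alpha x)
          || ((x == y.+1 :> nat) && ~~ step_up alpha y).

Definition fence_le (alpha : seq nat) : rel 'I_(sumn alpha).+1 :=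
  connect (@fence_step alpha).

Definition lower_ideal (alpha : seq nat) (I : {set 'I_(sumn alpha).+1}) : bool :=
  [forall x in I, forall y, fence_le y x ==> (y \in I)].

Definition rank_num (alpha : seq nat) (k : nat) : nat :=
  #|[set I : {set 'I_(sumn alpha).+1} | lower_ideal I & #|I| == k]|.

Definition rank_seq (alpha : seq nat) : seq nat :=
  mkseq (rank_num alpha) (sumn alpha).+2.

Definition rank_poly (alpha : seq nat) : {poly nat} :=
  (\sum_(k < (sumn alpha).+2) rank_num alpha k *: 'X^k)%R.

Definition unimodal (a : seq nat) : Prop :=
  exists j, [/\ j < size a,
    forall i, i < j -> nth 0 a i <= nth 0 a i.+1
  & forall i, j <= i -> i.+1 < size a -> nth 0 a i.+1 <= nth 0 a i].

Lemma fence_le_refl (alpha : seq nat) : reflexive (@fence_le alpha).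
Proof. exact: connect0. Qed.

Lemma fence_le_trans (alpha : seq nat) : transitive (@fence_le alpha).
Proof. exact: connect_trans. Qed.

Lemma fence_le_anti (alpha : seq nat) : antisymmetric (@fence_le alpha).
Proof.
pose n := sumn alpha.
pose h (m : nat) := count (step_up alpha) (iota 0 m)
                    + (n - count (predC (step_up alpha)) (iota 0 m)).
have hS m : m < n -> if step_up alpha m then h m < h m.+1 else h m.+1 < h m.
  move=> mn; have hm := count_predC (step_up alpha) (iota 0 m).
  have hm1 := count_predC (step_up alpha) (iota 0 m.+1).
  rewrite !size_iota in hm hm1; rewrite /h -[m.+1]addn1 iotaD add0n !count_cat /= !addn0.
  case: (step_up alpha m) => /=; first by rewrite addn0 addn1 addSn.
  rewrite addn0 addn1 ltn_add2l subnS prednK // subn_gt0.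
  by apply: leq_ltn_trans mn; rewrite -{2}hm leq_addl.
have hstep x y : @fence_step alpha x y -> h x < h y.
  case/orP => /andP [/eqP e u].
    have := hS x; rewrite u e; apply.
    by have := ltn_ord y; rewrite e.
  have := hS y; rewrite (negbTE u) e; apply.
  by have := ltn_ord x; rewrite e.
have hpath p x : path (@fence_step alpha) x p -> h x + size p <= h (last x p).
  elim: p x => [|y p IH] x /=; first by rewrite addn0.
  case/andP => /hstep xy /IH; apply: leq_trans.
  by rewrite addnS -addSn leq_add2r.
move=> x y /andP [/connectP [p px ey] /connectP [q qy ex]].
have := leq_trans (leq_addr _ _) (hpath _ _ qy); rewrite -ex => hyx.
have := hpath _ _ px; rewrite -ey => hxy.
have := leq_trans hxy hyx; rewrite -{2}[h x]addn0 leq_add2l leqn0 size_eq0.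
by move/eqP=> p0; rewrite ey p0.
Qed.

(* Main.v *)
Require Import Defs.
From mathcomp Require Import all_boot all_order all_algebra.
From mathcomp Require Import zify ring.

Set Implicit Arguments.
Unset Strict Implicit.
Unset Printing Implicit Defensive.

Import Order.TTheory GRing.Theory Num.Theory.
Local Open Scope ring_scope.

(** Read along the fence, the membership bits of an ideal are counted by products
    of the transfer matrices U = [[1,0],[1,q]] (step up) and D = [[1,q],[0,q]]
    (step down): with W the product over the N-1 steps, the rank polynomial is
    L = (1,q) W (1,1)^T, while the trace of W counts the ideals of a circular fence.

    Such a trace is palindromic: reversing coefficients exchanges U and D, and so
    does conjugation by a fixed matrix.  Closing the fence into a circular one in
    three ways gives
      q L = tr (W D U) - W_00,   L = tr (W U D) - q^2 W_11,   L = tr (W U) + q W_10,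
    where each entry of W is zero or a power of q times the rank polynomial of a
    shorter fence.  By induction the coefficients of the correction terms are
    monotone along pairs of indices with constant sum, and the three identities
    compare L_i with L_(N-1-i), L_(N+1-i) and L_(N-i) respectively.  These
    comparisons interlace the two halves of the sequence, so L is unimodal. *)

(** * Sequences compared along pairs of indices with constant sum *)

Definition sum_le (s : nat) (f : nat -> int) :=
  forall i j, (i <= j)%N -> (i + j = s)%N -> f i <= f j.

Definition sum_ge (s : nat) (f : nat -> int) :=
  forall i j, (i <= j)%N -> (i + j = s)%N -> f j <= f i.

(** Here d / 2 is the centre of the profile: of two positions up to d, the one nearer to it carries
    the larger value, and ties in distance are all resolved the same way by [inter_mid]. This is
    stronger than unimodality, because the induction compares correction terms at indices that need
    not be adjacent. *)
Record interlaced (d : nat) (f : nat -> int) : Prop := Interlaced {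
  inter_ge0 : forall i, 0 <= f i;
  inter_zero : forall i, (d < i)%N -> f i = 0;
  inter_below : forall s, (s < d)%N -> sum_le s f;
  inter_above : forall s, (d < s)%N -> sum_ge s f;
  inter_mid : sum_le d f \/ sum_ge d f }.

Lemma interlaced_sum d f s : interlaced d f -> sum_le s f \/ sum_ge s f.
Proof.
move=> [_ _ lo hi mid]; case: (ltngtP s d) => [/lo|/hi|->]; by [left|right|].
Qed.

Lemma incr_trans (f : nat -> int) m :
  (forall i, (i < m)%N -> f i <= f i.+1) ->
  forall i j, (i <= j <= m)%N -> f i <= f j.
Proof.
move=> fS i; elim=> [|j IH] /andP[ij jm]; first by rewrite (_ : i = 0%N) //; lia.
move: ij; rewrite leq_eqVlt => /predU1P[-> //|ij].
by apply: le_trans (fS j jm); apply: IH; lia.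
Qed.

Lemma decr_trans (f : nat -> int) m :
  (forall i, (m <= i)%N -> f i.+1 <= f i) ->
  forall i j, (m <= i <= j)%N -> f j <= f i.
Proof.
move=> fS i; elim=> [|j IH] /andP[mi ij]; first by rewrite (_ : i = 0%N) //; lia.
move: ij; rewrite leq_eqVlt => /predU1P[-> //|ij].
by apply: le_trans (fS j _) _; [lia | apply: IH; lia].
Qed.

(* Either middle inequality closes the chain
   [f d <= f 0 <= f (d-1) <= f 1 <= ...] or [f 0 <= f d <= f 1 <= ...]. *)
Lemma interlaced_of_sums d f :
  (forall i, 0 <= f i) -> (forall i, (d < i)%N -> f i = 0) ->
  (forall s, s.+1 = d -> sum_le s f) -> sum_ge d.+1 f ->
  sum_le d f \/ sum_ge d f -> interlaced d f.
Proof.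
move=> f0 fd lo hi mid; split=> //.
- case: mid => mid s sd i j ij es.
    (* One step to the right factors through a reflected index: f k <= f (d - k) <= f (k + 1), with
       sums d and d + 1. A right-hand index j is then reflected to d - j, which is still at least i
       because s < d. *)
    have up k : (k < uphalf d)%N -> f k <= f k.+1.
      move=> kd; have h := mid k (d - k)%N; have h' := hi k.+1 (d - k)%N.
      by apply: le_trans (h _ _) (h' _ _); lia.
    case: (leqP j (uphalf d)) => jd; first by apply: (incr_trans up); lia.
    by apply: le_trans (mid (d - j)%N j _ _); [apply: (incr_trans up)|..]; lia.
  have up k : (k < d./2)%N -> f k <= f k.+1.
    move=> kd; have h := lo d.-1 _ k (d.-1 - k)%N; have h' := mid k.+1 (d.-1 - k)%N.
    by apply: le_trans (h _ _ _) (h' _ _); lia.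
  case: (leqP j d./2) => jd; first by apply: (incr_trans up); lia.
  by apply: le_trans (lo d.-1 _ (d.-1 - j)%N j _ _); [apply: (incr_trans up)|..]; lia.
- case: mid => mid s sd i j ij es.
    have dn k : (uphalf d <= k)%N -> f k.+1 <= f k.
      move=> kd; case: (leqP k d) => kd'; last by rewrite fd //; lia.
      have h := mid (d - k)%N k; have h' := hi (d - k)%N k.+1.
      by apply: le_trans (h' _ _) (h _ _); lia.
    case: (leqP (uphalf d) i) => id; first by apply: (decr_trans dn); lia.
    by apply: le_trans (hi i (d.+1 - i)%N _ _); [apply: (decr_trans dn)|..]; lia.
  have dn k : (d./2 <= k)%N -> f k.+1 <= f k.
    move=> kd; case: (ltnP k d) => kd'; last by rewrite fd //; lia.
    have h := lo d.-1 _ (d.-1 - k)%N k; have h' := mid (d.-1 - k)%N k.+1.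
    by apply: le_trans (h' _ _) (h _ _ _); lia.
  case: (leqP (d./2) i) => id; first by apply: (decr_trans dn); lia.
  by apply: le_trans (mid i (d - i)%N _ _); [apply: (decr_trans dn)|..]; lia.
Qed.

Lemma interlaced_ext d f g : f =1 g -> interlaced d f -> interlaced d g.
Proof.
move=> fg [f0 fz lo hi mid]; split=> [i|i id|s sd i j ij e|s sd i j ij e|].
- by rewrite -fg.
- by rewrite -fg fz.
- by rewrite -!fg (lo s).
- by rewrite -!fg (hi s).
- by case: mid => mid; [left|right] => i j ij e; rewrite -!fg mid.
Qed.

(** The parameter d is twice the centre rather than the degree, so a shift by c adds 2c to it. A
    pair whose left index falls into the new zeros and whose sum exceeds d + 2c has its right index
    beyond d + c, where the value vanishes too. *)
Lemma interlaced_shift c d (p : {poly int}) :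
  interlaced d (fun i => p`_i) -> interlaced (d + c.*2)%N (fun i => ('X^c * p)`_i).
Proof.
have E i : ('X^c * p)`_i = if (i < c)%N then 0 else p`_(i - c) by rewrite coefXnM.
move=> [f0 fz lo hi mid]; split=> [i|i id|s sd i j ij e|s sd i j ij e|] /=.
- by rewrite E; case: ifP.
- by rewrite E; case: ifP => // ic; apply: fz; lia.
- rewrite !E; case: (ltnP i c) => ic; first by case: ifP.
  by rewrite ifN; [apply: (lo (s - c.*2)%N)|]; lia.
- rewrite !E; case: (ltnP i c) => ic; last first.
    by rewrite ifN; [apply: (hi (s - c.*2)%N)|]; lia.
  by case: ifP => // jc; rewrite fz //; lia.
case: mid => mid; [left|right] => i j ij e; rewrite !E.
  case: (ltnP i c) => ic; first by case: ifP.
  by rewrite ifN; [apply: mid|]; lia.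
case: (ltnP i c) => ic; last by rewrite ifN; [apply: mid|]; lia.
by case: ifP => // jc; rewrite fz //; lia.
Qed.

Lemma interlaced0 d : interlaced d (fun=> 0).
Proof. by split=> //; left. Qed.

Lemma interlaced1 : interlaced 0 (fun i => (1 : {poly int})`_i).
Proof.
split=> [i|i i0|s|s s0 i j ij e|] //=.
- by rewrite coef1 ler0n.
- by rewrite coef1; case: i i0.
- by rewrite !coef1; case: j ij e => [|j]; [case: i => //; lia|rewrite ler0n].
- by left=> i j _ /eqP; rewrite addn_eq0 => /andP[/eqP-> /eqP->].
Qed.

(** * Transfer matrices and the conjugation exchanging up and down steps *)

(** Rows carry the membership bit of an element, columns that of the next one; only the column bit
    is weighted by q. *)
Definition stepU : 'M[{poly int}]_2 :=
  \matrix_(i, j) if i == 0 then (j == 0)%:R else (if j == 0 then 1 else 'X).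
Definition stepD : 'M[{poly int}]_2 :=
  \matrix_(i, j) if j == 0 then (i == 0)%:R else 'X.
Definition step (b : bool) := if b then stepU else stepD.
Definition word_mx (w : seq bool) := foldr (fun b M => step b *m M) 1%:M w.

Lemma mulmx2E (R : nzSemiRingType) (A B : 'M[R]_2) i j :
  (A *m B) i j = A i 0 * B 0 j + A i 1 * B 1 j.
Proof.
rewrite mxE !big_ord_recl big_ord0 addr0.
by congr (A i _ * B _ j + A i _ * B _ j); apply: val_inj.
Qed.

Lemma mxtrace2E (R : nzSemiRingType) (A : 'M[R]_2) : \tr A = A 0 0 + A 1 1.
Proof.
rewrite /mxtrace !big_ord_recl big_ord0 addr0.
by congr (A _ _ + A _ _); apply: val_inj.
Qed.

Lemma ord2P (P : 'I_2 -> Prop) : P 0 -> P 1 -> forall i, P i.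
Proof.
move=> P0 P1 [[|[|//]] i2]; [move: P0|move: P1]; congr P; exact: val_inj.
Qed.

Lemma stepE b : [/\ step b 0 0 = 1, step b 0 1 = if b then 0 else 'X,
  step b 1 0 = (if b then 1 else 0) & step b 1 1 = 'X].
Proof. by case: b; split; rewrite mxE. Qed.

Lemma word_mx_cat u v : word_mx (u ++ v) = word_mx u *m word_mx v.
Proof. by elim: u => [|b u IH] /=; rewrite ?mul1mx // IH mulmxA. Qed.

Lemma word_mx_rcons w b : word_mx (rcons w b) = word_mx w *m step b.
Proof. by rewrite -cats1 word_mx_cat /= mulmx1. Qed.

Definition flip_mx : 'M[{poly int}]_2 :=
  \matrix_(i, j) if i == 0 then (if j == 0 then 1 - 'X else 'X)
                 else (if j == 0 then 1 else 'X - 1).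

Lemma flip_mxE : [/\ flip_mx 0 0 = 1 - 'X, flip_mx 0 1 = 'X,
  flip_mx 1 0 = 1 & flip_mx 1 1 = 'X - 1].
Proof. by split; rewrite mxE. Qed.

Lemma flip_step b : flip_mx *m step b = step (~~ b) *m flip_mx.
Proof.
have [a0 a1 a2 a3] := flip_mxE; have [b0 b1 b2 b3] := stepE b.
have [c0 c1 c2 c3] := stepE (~~ b).
by apply/matrixP; apply: ord2P; apply: ord2P;
  rewrite !mulmx2E ?a0 ?a1 ?a2 ?a3 ?b0 ?b1 ?b2 ?b3 ?c0 ?c1 ?c2 ?c3;
  case: b {b0 b1 b2 b3 c0 c1 c2 c3} => /=; ring.
Qed.

Lemma flip_sqr : flip_mx *m flip_mx = ('X ^+ 2 - 'X + 1)%:M.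
Proof.
have [a0 a1 a2 a3] := flip_mxE.
by apply/matrixP; apply: ord2P; apply: ord2P;
  rewrite !mulmx2E !mxE /=; ring.
Qed.

Lemma flip_word w : flip_mx *m word_mx w = word_mx (map negb w) *m flip_mx.
Proof.
by elim: w => [|b w IH] /=; rewrite ?mulmx1 ?mul1mx // mulmxA flip_step -!mulmxA IH.
Qed.

(** The flip matrix intertwines a word with its negation but has no inverse over the polynomials.
    Its square is a nonzero scalar, so both traces are multiplied by that scalar, which is cancelled
    at the end. *)
Lemma tr_word_negb w : \tr (word_mx (map negb w)) = \tr (word_mx w).
Proof.
have c0 : ('X ^+ 2 - 'X + 1 : {poly int}) != 0.
  by apply/eqP => /(congr1 (horner^~ 0)); rewrite !hornerE.
apply: (mulfI c0); rewrite -!mxtraceZ -!mul_scalar_mx -flip_sqr.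
by rewrite -[in RHS]mulmxA flip_word [RHS]mxtrace_mulC -[in RHS]mulmxA [RHS]mxtrace_mulC.
Qed.

(** * Reversal of coefficients and palindromic traces *)

Record reversed (n : nat) (p q : {poly int}) : Prop := Reversed {
  rev_sizel : forall i, (n < i)%N -> p`_i = 0;
  rev_sizer : forall i, (n < i)%N -> q`_i = 0;
  rev_coef : forall i j, (i + j = n)%N -> p`_i = q`_j }.

Lemma reversedD n p q p' q' :
  reversed n p q -> reversed n p' q' -> reversed n (p + p') (q + q').
Proof.
move=> [pz qz pq] [pz' qz' pq']; split=> [i ni|i ni|i j ij]; rewrite !coefD.
- by rewrite pz ?pz'.
- by rewrite qz ?qz'.
- by rewrite (pq i j) ?(pq' i j).
Qed.

Lemma reversed_sym n p q : reversed n p q -> reversed n q p.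
Proof. by move=> [pz qz pq]; split=> // i j ij; rewrite (pq j i) // addnC. Qed.

Lemma reversedXr n p q : reversed n p q -> reversed n.+1 p ('X * q).
Proof.
move=> [pz qz pq]; split=> [i ni|i ni|i j ij].
- by rewrite pz //; lia.
- by rewrite coefXM; case: i ni => //= i ni; rewrite qz.
- rewrite coefXM; case: j ij => [|j] ij /=; first by rewrite pz //; lia.
  by apply: pq; lia.
Qed.

Lemma reversedXl n p q : reversed n p q -> reversed n.+1 ('X * p) q.
Proof. by move/reversed_sym/reversedXr/reversed_sym. Qed.

Lemma reversed0 n : reversed n 0 0.
Proof. by split=> *; rewrite !coef0. Qed.

Lemma reversed1 : reversed 0 1 1.
Proof.
by split=> [[]|[]|[|i] [|j]] //= *; rewrite ?coef1 //; lia.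
Qed.

(** Complementing all membership bits turns every step over and sends k chosen elements to [size w]
    - k. In ['I_2], [1 - i] is the opposite bit. *)
Lemma word_mx_rev w : forall i j : 'I_2,
  reversed (size w) (word_mx w i j) (word_mx (map negb w) (1 - i) (1 - j)).
Proof.
elim: w => [|b w IH] /= i j.
  move: i j; apply: ord2P; apply: ord2P; rewrite !mxE /=;
    by [apply: reversed0|apply: reversed1].
have [s0 s1 s2 s3] := stepE b; have [t0 t1 t2 t3] := stepE (~~ b).
have H0 := IH 0 j; have H1 := IH 1 j; rewrite subr0 in H0; rewrite subrr in H1.
move: i; apply: ord2P; rewrite ?subr0 ?subrr !mulmx2E ?s0 ?s1 ?s2 ?s3 ?t0 ?t1 ?t2 ?t3;
  case: b {s0 s1 s2 s3 t0 t1 t2 t3} => /=; rewrite ?mul1r ?mul0r ?addr0 ?add0r.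
- exact: reversedXr.
- by rewrite [X in reversed _ _ X]addrC; apply: reversedD;
    [apply: reversedXr|apply: reversedXl].
- by rewrite [X in reversed _ _ X]addrC; apply: reversedD;
    [apply: reversedXr|apply: reversedXl].
- exact: reversedXl.
Qed.

Lemma word_mx_size w i j k : (size w < k)%N -> (word_mx w i j)`_k = 0.
Proof. exact: rev_sizel (word_mx_rev w i j) k. Qed.

Lemma tr_word_sym w i j :
  (i + j = size w)%N -> (\tr (word_mx w))`_i = (\tr (word_mx w))`_j.
Proof.
move=> ij; rewrite -[in RHS]tr_word_negb !mxtrace2E !coefD addrC.
rewrite (rev_coef (word_mx_rev w 1 1) ij) (rev_coef (word_mx_rev w 0 0) ij).
by rewrite subrr subr0.
Qed.

Lemma word_mx_ge0 w i j k : 0 <= (word_mx w i j)`_k.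
Proof.
elim: w i k => [|b w IH] i k /=.
  by rewrite mxE; case: eqP; rewrite ?coef1 ?coef0 ?ler0n.
have [s0 s1 s2 s3] := stepE b; move: i; apply: ord2P;
  rewrite mulmx2E ?s0 ?s1 ?s2 ?s3 coefD; apply: addr_ge0;
  case: b {s0 s1 s2 s3}; rewrite ?mul1r ?mul0r ?coef0 ?coefXM //; by case: ifP.
Qed.

(** * Matrix entries as rank polynomials of shorter fences *)

Definition fence_poly (w : seq bool) : {poly int} :=
  let M := word_mx w in M 0 0 + M 0 1 + 'X * (M 1 0 + M 1 1).

(** A first bit 0 forces 0 along the initial up steps; the element after the first down step is free
    and starts the fence [v]. The next three lemmas trim likewise for a first bit 1 and for a
    prescribed last bit, each further element forced into the ideal giving a factor q. *)
Lemma word_mx_row0 w :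
  (forall j, word_mx w 0 j = (0 == j)%:R) \/
  exists2 v, (size v < size w)%N &
    forall j, word_mx w 0 j = word_mx v 0 j + 'X * word_mx v 1 j.
Proof.
elim: w => [|b w IH]; first by left=> j; rewrite mxE.
have [s0 s1 _ _] := stepE b.
have E j : word_mx (b :: w) 0 j =
    if b then word_mx w 0 j else word_mx w 0 j + 'X * word_mx w 1 j.
  by rewrite mulmx2E s0 s1 mul1r; case: b {s0 s1}; rewrite ?mul0r ?addr0.
case: b {s0 s1} E => E; last by right; exists w.
case: IH => [h|[v vw h]]; first by left=> j; rewrite E.
by right; exists v => [|j]; rewrite ?E //=; lia.
Qed.

Lemma word_mx_row1 w :
  (forall j, word_mx w 1 j = 'X^(size w) * (1 == j)%:R) \/
  exists p v, (p + (size v).+1 = size w)%N /\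
    forall j, word_mx w 1 j = 'X^p * (word_mx v 0 j + 'X * word_mx v 1 j).
Proof.
elim: w => [|b w IH]; first by left=> j; rewrite mxE mul1r.
have [_ _ s0 s1] := stepE b.
have E j : word_mx (b :: w) 1 j =
    if b then word_mx w 0 j + 'X * word_mx w 1 j else 'X * word_mx w 1 j.
  by rewrite mulmx2E s0 s1; case: b {s0 s1}; rewrite ?mul1r ?mul0r ?add0r.
case: b {s0 s1} E => E; first by right; exists 0%N, w; split=> // j; rewrite E mul1r.
case: IH => [h|[p [v [vw h]]]]; first by left=> j; rewrite E h mulrA -exprS.
by right; exists p.+1, v; split=> [|j]; rewrite ?E ?h ?mulrA -?exprS //=; lia.
Qed.

Lemma word_mx_col0 w :
  (forall i, word_mx w i 0 = (i == 0)%:R) \/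
  exists2 v, (size v < size w)%N &
    forall i, word_mx w i 0 = word_mx v i 0 + word_mx v i 1.
Proof.
elim/last_ind: w => [|w b IH]; first by left=> i; rewrite mxE.
have [s0 _ s1 _] := stepE b.
have E i : word_mx (rcons w b) i 0 =
    if b then word_mx w i 0 + word_mx w i 1 else word_mx w i 0.
  by rewrite word_mx_rcons mulmx2E s0 s1 mulr1; case: b {s0 s1};
    rewrite ?mulr1 ?mulr0 ?addr0.
case: b {s0 s1} E => E; first by right; exists w => //; rewrite size_rcons.
case: IH => [h|[v vw h]]; first by left=> i; rewrite E.
by right; exists v => [|i]; rewrite ?E ?size_rcons //=; lia.
Qed.

Lemma word_mx_col1 w :
  (forall i, word_mx w i 1 = 'X^(size w) * (i == 1)%:R) \/
  exists p v, (p + (size v).+1 = size w)%N /\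
    forall i, word_mx w i 1 = 'X^(p.+1) * (word_mx v i 0 + word_mx v i 1).
Proof.
elim/last_ind: w => [|w b IH]; first by left=> i; rewrite mxE mul1r.
have [_ s0 _ s1] := stepE b.
have E i : word_mx (rcons w b) i 1 =
    if b then 'X * word_mx w i 1 else 'X * (word_mx w i 0 + word_mx w i 1).
  by rewrite word_mx_rcons mulmx2E s0 s1; case: b {s0 s1};
    rewrite ?mulr0 ?add0r ?mulrDr ![_ * 'X]mulrC.
rewrite size_rcons; case: b {s0 s1} E => E; last first.
  by right; exists 0%N, w; split=> // i; rewrite E.
case: IH => [h|[p [v [vw h]]]]; first by left=> i; rewrite E h mulrA -exprS.
by right; exists p.+1, v; split=> [|i]; rewrite ?E ?h ?mulrA -?exprS //=; lia.
Qed.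

Lemma le_of_eqD (R : numDomainType) (a b c d : R) : a + c = b + d -> d <= c -> a <= b.
Proof. by move=> e dc; rewrite -(lerD2r c) e lerD2l. Qed.

(** * The inductive step: three circular closures *)

Section Step.

Variable w : seq bool.
Hypothesis IH : forall v, (size v < size w)%N ->
  interlaced (size v).+1 (fun i => (fence_poly v)`_i).

Let interlaced_poly d p := interlaced d (fun i => (p : {poly int})`_i).

(** Trimming both ends leaves 1 or a shorter fence. The bound on d puts the pair sum [size w] + 2,
    at which this entry is compared, above d. *)
Lemma word_mx00_interlaced :
  exists2 d, (d <= size w)%N & interlaced_poly d (word_mx w 0 0).
Proof.
have n1 : interlaced_poly 0 1 by exact: interlaced1.
case: (word_mx_row0 w) => [->|[v vw ->]]; first by exists 0%N.
case: (word_mx_col0 v) => [h|[u uv h]].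
  by exists 0%N => //; rewrite !h /= mulr0 addr0.
exists (size u).+1; first by lia.
by rewrite !h; apply: IH; lia.
Qed.

(** The power c is kept explicit: after the further factor q^2, the parameter d + 2 (c + 2) equals
    [size w] + c + 4, which exceeds the pair sum [size w] + 2. *)
Lemma word_mx11_interlaced :
  exists d c p, [/\ (d + c = size w)%N, word_mx w 1 1 = 'X^c * p & interlaced_poly d p].
Proof.
have n1 : interlaced_poly 0 1 by exact: interlaced1.
case: (word_mx_row1 w) => [h|[k [v [vw h]]]]; first by exists 0%N, (size w), 1.
case: (word_mx_col1 v) => [h'|[l [u [uv h']]]].
  exists 0%N, (size w), 1; split=> //; rewrite h !h' /= mulr0 add0r !mulr1.
  by rewrite -exprS -exprD vw.
exists (size u).+1, (k + l.+1)%N, (fence_poly u); split; first by lia.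
  by rewrite h !h' /fence_poly exprD; ring.
by apply: IH; lia.
Qed.

(** No bound on d is required, since either direction of this comparison yields a middle
    inequality. *)
Lemma word_mx10_interlaced : exists d, interlaced_poly d (word_mx w 1 0).
Proof.
have n1 : interlaced_poly 0 1 by exact: interlaced1.
case: (word_mx_row1 w) => [->|[k [v [vw ->]]]].
  by exists 0%N; rewrite mulr0; apply: interlaced_ext (interlaced0 0) => i; rewrite coef0.
case: (word_mx_col0 v) => [h|[u uv h]].
  by exists (0 + k.*2)%N; apply: interlaced_shift; rewrite !h /= mulr0 addr0.
exists ((size u).+1 + k.*2)%N; apply: interlaced_shift.
by rewrite !h; apply: IH; lia.
Qed.

Let M := word_mx w.

(** An up step from the last element back to the first bars exactly the ideals containing the first
    but not the last. In the next two lemmas a new element closes the circle: above both ends, it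
    can be chosen only if both ends are; below both ends, it can be omitted only if both are. *)
Lemma tr_rconsU : \tr (word_mx (rcons w true)) = fence_poly w - 'X * M 1 0.
Proof.
have [s0 s1 s2 s3] := stepE true.
rewrite mxtrace2E word_mx_rcons !mulmx2E s0 s1 s2 s3 /fence_poly -/M; ring.
Qed.

Lemma tr_rconsUD :
  \tr (word_mx (rcons (rcons w true) false)) = fence_poly w + 'X^2 * M 1 1.
Proof.
have [s0 s1 s2 s3] := stepE true; have [t0 t1 t2 t3] := stepE false.
rewrite mxtrace2E !word_mx_rcons !mulmx2E s0 s1 s2 s3 t0 t1 t2 t3 /fence_poly -/M; ring.
Qed.

Lemma tr_rconsDU :
  \tr (word_mx (rcons (rcons w false) true)) = 'X * fence_poly w + M 0 0.
Proof.
have [s0 s1 s2 s3] := stepE true; have [t0 t1 t2 t3] := stepE false.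
rewrite mxtrace2E !word_mx_rcons !mulmx2E s0 s1 s2 s3 t0 t1 t2 t3 /fence_poly -/M; ring.
Qed.

Lemma fence_poly_step : interlaced (size w).+1 (fun i => (fence_poly w)`_i).
Proof.
apply: interlaced_of_sums.
- by move=> i; rewrite /fence_poly !coefD coefXM; case: ifP => _;
    rewrite ?coefD !addr_ge0 ?word_mx_ge0.
- move=> i wi; rewrite /fence_poly !coefD coefXM; case: i wi => //= i wi.
  by rewrite coefD !word_mx_size ?addr0 //; lia.
- move=> _ [->] i j ij e; have [d dw nd] := word_mx00_interlaced.
  (* The polynomial enters this trace multiplied by q, so the symmetry about [size w] + 2 relates
     its coefficients at i and j with i + j = [size w]. *)
  have h := @tr_word_sym (rcons (rcons w false) true) i.+1 j.+1.
  rewrite tr_rconsDU !size_rcons !coefD !coefXM /= in h.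
  apply: (le_of_eqD (h _)); first by lia.
  by apply: (inter_above nd (s := (size w).+2)); lia.
- move=> i j ij e; have [d [c [p [dc Mp nd]]]] := word_mx11_interlaced.
  have h := @tr_word_sym (rcons (rcons w true) false) j i.
  rewrite tr_rconsUD !size_rcons ![(fence_poly w + _)`__]coefD /M Mp mulrA -exprD in h.
  apply: (le_of_eqD (h _)); first by lia.
  by apply: (inter_below (interlaced_shift (2 + c) nd) (s := (size w).+2)); lia.
have [d nd] := word_mx10_interlaced.
have := interlaced_sum (size w).+1 (interlaced_shift 1 nd); rewrite expr1.
have sym i j : (i + j = (size w).+1)%N -> (fence_poly w)`_i + ('X * M 1 0)`_j
      = (fence_poly w)`_j + ('X * M 1 0)`_i.
  move=> ij; apply/eqP; rewrite -subr_eq addrAC eq_sym -subr_eq eq_sym -!coefB -tr_rconsU.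
  by apply/eqP; apply: tr_word_sym; rewrite size_rcons.
case=> h; [left|right] => i j ij e.
  exact: le_of_eqD (sym i j e) (h i j ij e).
by apply: le_of_eqD (sym j i _) (h i j ij e); rewrite addnC.
Qed.

End Step.

Lemma fence_poly_interlaced w :
  interlaced (size w).+1 (fun i => (fence_poly w)`_i).
Proof.
have [n] := ubnP (size w); elim: n w => // n IHn w wn.
by apply: fence_poly_step => v vw; apply: IHn; lia.
Qed.

(** * Ideals as bit sequences accepted by the transfer matrices *)

(* [u] tells whether the step from the element with bit [a] to the one with bit [b]
   goes up. *)
Definition step_ok (u a b : bool) := if u then b ==> a else a ==> b.

Fixpoint ideal_bits (w : seq bool) (a : bool) (s : seq bool) : bool :=
  match w, s with
  | u :: w', b :: s' => step_ok u a b && ideal_bits w' b s'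
  | _, _ => true
  end.

Lemma ideal_bitsP w a s : size s = size w ->
  reflect (forall j, (j < size w)%N ->
             step_ok (nth false w j) (nth false (a :: s) j) (nth false (a :: s) j.+1))
          (ideal_bits w a s).
Proof.
elim: w a s => [|u w IH] a [|b s] //=; first by move=> _; apply: ReflectT.
case=> sw.
apply: (iffP andP) => [[ok /(IH _ _ sw) h] [|j] //|h]; first exact: h.
by split; [apply: (h 0%N)|apply/IH=> // j jw; apply: (h j.+1)].
Qed.

Lemma sum_tupleS (R : nmodType) (T : finType) n (F : n.+1.-tuple T -> R) :
  \sum_t F t = \sum_a \sum_(t : n.-tuple T) F [tuple of a :: t].
Proof.
rewrite pair_bigA /= (reindex (fun p : T * n.-tuple T => [tuple of p.1 :: p.2])) //=.
exists (fun t => (thead t, [tuple of behead t])) => [[a t] _|t _] /=.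
  by rewrite theadE; congr (_, _); apply: val_inj.
by rewrite -tuple_eta.
Qed.

Definition bit_ord (a : bool) : 'I_2 := if a then 1 else 0.

Lemma sum_ideal_bits n w a : size w = n ->
  \sum_(t : n.-tuple bool) 'X^(count id t) *+ ideal_bits w a t
  = word_mx w (bit_ord a) 0 + word_mx w (bit_ord a) 1.
Proof.
elim: w n a => [|u w IH] [|n] //= a.
  move=> _; rewrite (big_pred1 [tuple]) => [|t]; last by rewrite [t]tuple0 /= eqxx.
  by rewrite !mxE; case: a; rewrite /= ?add0r ?addr0.
case=> wn; rewrite sum_tupleS big_bool /=.
have E b : \sum_(t : n.-tuple bool)
      'X^(count id [tuple of b :: t]) *+ ideal_bits (u :: w) a [tuple of b :: t]
    = 'X^b * (word_mx w (bit_ord b) 0 + word_mx w (bit_ord b) 1) *+ step_ok u a b.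
  rewrite -(IH n) // mulr_sumr -sumrMnl; apply: eq_bigr => t _ /=.
  by rewrite -mulnb mulrnAr exprD mulnC mulrnA.
rewrite !E !mulmx2E /bit_ord expr1 expr0 mul1r.
have [s0 s1 s2 s3] := stepE u.
by case: a {E}; case: u s0 s1 s2 s3 => s0 s1 s2 s3;
  rewrite ?s0 ?s1 ?s2 ?s3 /= ?mulr1n ?mulr0n; ring.
Qed.

Lemma fence_poly_bits n w : size w = n ->
  fence_poly w = \sum_(t : n.+1.-tuple bool)
    'X^(count id t) *+ ideal_bits w (thead t) (behead t).
Proof.
move=> wn; rewrite sum_tupleS big_bool /=.
have E b : \sum_(t : n.-tuple bool)
      'X^(count id [tuple of b :: t])
        *+ ideal_bits w (thead [tuple of b :: t]) (behead [tuple of b :: t])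
    = 'X^b * (word_mx w (bit_ord b) 0 + word_mx w (bit_ord b) 1).
  rewrite -(sum_ideal_bits _ wn) mulr_sumr; apply: eq_bigr => t _ /=.
  by rewrite theadE mulrnAr exprD.
by rewrite !E /fence_poly /= expr1 expr0 mul1r addrC.
Qed.

Section Ideals.

Variable alpha : seq nat.
Let n := sumn alpha.

Definition fence_word := mkseq (step_up alpha) (sumn alpha).

Definition set_of_bits (t : n.+1.-tuple bool) : {set 'I_n.+1} := [set i | tnth t i].

Lemma set_of_bits_bij : bijective set_of_bits.
Proof.
exists (fun I : {set 'I_n.+1} => [tuple i \in I | i < n.+1]) => [t|I].
  by apply: eq_from_tnth => i; rewrite tnth_mktuple inE.
by apply/setP => i; rewrite inE tnth_mktuple.
Qed.

Lemma card_set_of_bits t : #|set_of_bits t| = count id t.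
Proof. by rewrite -sum1_count big_tuple sum1_card cardsE. Qed.

(** Closure under the generating steps propagates along any path of the connectivity relation. *)
Lemma lower_idealP (I : {set 'I_n.+1}) :
  reflect (forall x y, fence_step y x -> x \in I -> y \in I) (lower_ideal I).
Proof.
apply: (iffP forall_inP) => [h x y yx xI|h x xI].
  by have /forallP/(_ y)/implyP := h x xI; apply; apply: connect1.
apply/forallP => y; apply/implyP => /connectP[p]; elim: p y => [|z p IH] y /=.
  by move=> _ <-.
by case/andP=> yz zp xp; apply: h yz _; apply: IH.
Qed.

Lemma lower_ideal_bits t :
  lower_ideal (set_of_bits t) = ideal_bits fence_word (thead t) (behead t).
Proof.
have wn : size fence_word = n by rewrite size_mkseq.
have tE i : (i \in set_of_bits t) = nth false t i by rewrite inE (tnth_nth false).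
have ht : thead t :: behead t = t by rewrite [in RHS](tuple_eta t).
apply/lower_idealP/ideal_bitsP; first by rewrite size_behead size_tuple wn.
  rewrite wn ht => h j jn; rewrite nth_mkseq // /step_ok.
  have j1 : (j < n.+1)%N by lia.
  have hj := h (Ordinal j1) (Ordinal (jn : (j.+1 < n.+1)%N)).
  have hj' := h (Ordinal (jn : (j.+1 < n.+1)%N)) (Ordinal j1).
  move: hj hj'; rewrite /fence_step !tE /= !eqxx.
  by case: (step_up alpha j) => /= hj hj'; apply/implyP; [apply: hj'|apply: hj; rewrite orbT].
rewrite wn ht => h x y /orP[]/andP[/eqP e up]; rewrite !tE e.
  have := h y; rewrite nth_mkseq ?up; last by have := ltn_ord x; lia.
  by move=> hy; apply/implyP/hy; have := ltn_ord x; lia.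
have := h x; rewrite nth_mkseq ?(negbTE up); last by have := ltn_ord y; lia.
by move=> hy; apply/implyP/hy; have := ltn_ord y; lia.
Qed.

Lemma coef_fence_poly k : (fence_poly fence_word)`_k = (rank_num alpha k)%:Z.
Proof.
rewrite (@fence_poly_bits n) ?size_mkseq // coef_sum /rank_num -sum1dep_card.
rewrite (reindex set_of_bits) /=; last exact/onW_bij/set_of_bits_bij.
rewrite [in RHS]big_mkcond /= -[RHS]natz natr_sum; apply: eq_bigr => t _.
rewrite coefMn coefXn lower_ideal_bits card_set_of_bits eq_sym.
by case: ideal_bits; case: eqP.
Qed.

(* Hence [rank_poly], whose coefficient sequence is normalised, loses no entry. *)
Lemma rank_num_full : rank_num alpha n.+1 = 1%N.
Proof.
rewrite /rank_num (_ : [set _ | _] = [set [set: 'I_n.+1]]) ?cards1 //.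
apply/setP => I; rewrite !inE; apply/andP/eqP => [[_ /eqP cI]|->].
  by apply/eqP; rewrite eqEcard subsetT cI cardsT card_ord /=.
by rewrite cardsT card_ord; split=> //; apply/lower_idealP => x y; rewrite !inE.
Qed.

Lemma rank_polyE : rank_poly alpha = rank_seq alpha :> seq nat.
Proof.
have E : rank_poly alpha = \poly_(k < n.+2) rank_num alpha k by rewrite poly_def.
have sz : size (rank_poly alpha) = n.+2 by rewrite E size_poly_eq //= rank_num_full.
apply: (@eq_from_nth _ 0%N) => [|i]; first by rewrite sz size_mkseq.
by rewrite sz => ni; rewrite nth_mkseq // E coef_poly ni.
Qed.

End Ideals.

(** * From interlacing to unimodality *)

Lemma interlaced_unimodal (a : seq nat) d : size a = d.+1 ->
  interlaced d (fun i => (nth 0%N a i)%:Z) -> unimodal a.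
Proof.
move=> sz [_ _ lo hi mid].
have up i : (i.*2.+1 < d)%N -> (nth 0 a i <= nth 0 a i.+1)%N.
  by move=> id; have := lo i.*2.+1 id i i.+1; rewrite lez_nat; apply; lia.
have dn i : (d < i.*2.+1)%N -> (nth 0 a i.+1 <= nth 0 a i)%N.
  by move=> id; have := hi i.*2.+1 id i i.+1; rewrite lez_nat; apply; lia.
(* Adjacent indices i and i + 1 have sum 2i + 1, so only the central pair for odd d is still open;
   comparing it decides which of the two indices is the peak. For even d both candidates
   coincide. *)
have [le|ge] := leqP (nth 0%N a d./2) (nth 0%N a d./2.+1); last first.
  exists d./2; split=> [|i id|i id _]; rewrite ?sz; [lia|apply: up; lia|].
  move: id; rewrite leq_eqVlt => /predU1P[<-|id]; [exact: ltnW|apply: dn; lia].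
exists (uphalf d); split=> [|i id|i id _]; rewrite ?sz; [lia| |apply: dn; lia].
by have [->//|id'] : (i = d./2 \/ i.*2.+1 < d)%N by [lia|]; apply: up.
Qed.

Lemma rank_seq_unimodal alpha : unimodal (rank_seq alpha).
Proof.
apply: (@interlaced_unimodal _ (sumn alpha).+1); first by rewrite size_mkseq.
have := fence_poly_interlaced (fence_word alpha); rewrite size_mkseq => fi.
apply: interlaced_ext (fi) => i; case: (ltnP i (sumn alpha).+2) => ni.
  by rewrite nth_mkseq // coef_fence_poly.
(* Past the end, the default 0 of [nth] agrees with the vanishing coefficients. *)
by rewrite (inter_zero fi ni) nth_default ?size_mkseq.
Qed.

Local Close Scope ring_scope.

Theorem theorem1p1 (n : nat) (alpha : seq nat)
    (alpha_comp : is_composition n alpha) (s_ge1 : 1 <= size alpha) :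
  unimodal (rank_seq alpha) /\ unimodal (rank_poly alpha).
Proof. by rewrite rank_polyE; split; apply: rank_seq_unimodal. Qed.
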